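(* Let $a<b$ be real numbers, let $f:\mathbb{N}_a\cap{_{b}\mathbb{N}}\to\mathbb{R}$ and let $f^*:\mathbb{N}_{-b}\cap{_{-a}\mathbb{N}}\to\mathbb{R}$, $f^*(t)=f(-t)$, be its symmetric dual. Let $n\geq 1$ be an integer and $n-1<\alpha\leq n$. Then for every $t\in\mathbb{N}_{a+n}\cap{_{b}\mathbb{N}}$, $$(\Delta_a^{\alpha}f)(\rho^{\alpha}(t))=({_{-a}\Delta^{\alpha}}f^* )(-\rho^{\alpha}(t)),$$ where $\rho^{\alpha}(t)=t-\alpha$.
   Context: For real $a,b$: $\mathbb{N}_a=\{a,a+1,\ldots\}$, ${_{b}\mathbb{N}}=\{b,b-1,\ldots\}$. $\sigma(t)=t+1$. $\Delta f(t)=f(t+1)-f(t)$, $\nabla f(t)=f(t)-f(t-1)$, with iterates $\Delta^n,\nabla^n$, and $\nabla_{\circleddash}^n=(-1)^n\nabla^n$. Factorial function: $t^{(\alpha)}=\Gamma(t+1)/\Gamma(t+1-\alpha)$, with the convention that division at a pole yields zero. For $\beta>0$, delta left and right fractional sums: $$\Delta_a^{-\beta}f(t)=\frac{1}{\Gamma(\beta)}\sum_{s=a}^{t-\beta}(t-\sigma(s))^{(\beta-1)}f(s)\quad(t\in\mathbb{N}_{a+\beta}),\qquad {_{b}\Delta^{-\beta}}f(t)=\frac{1}{\Gamma(\beta)}\sum_{s=t+\beta}^{b}(s-\sigma(t))^{(\beta-1)}f(s)\quad(t\in{_{b-\beta}\mathbb{N}});$$ for $\beta=0$ both operators are the identity.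 For $n-1<\alpha\leq n$, the delta left and right (Riemann--Liouville) fractional differences are $$\Delta_a^{\alpha}f(t)=\Delta^n\Delta_a^{-(n-\alpha)}f(t)\quad(t\in\mathbb{N}_{a+(n-\alpha)}),\qquad {_{b}\Delta^{\alpha}}f(t)=\nabla_{\circleddash}^n\,{_{b}\Delta^{-(n-\alpha)}}f(t)\quad(t\in{_{b-(n-\alpha)}\mathbb{N}}).$$ For functions defined only on a finite set of points, these are considered at those $t$ for which all values occurring are defined. *)

(* Defs.v *)
From mathcomp Require Import all_boot all_order all_algebra.
From mathcomp Require Import all_classical all_reals all_analysis.

Set Implicit Arguments.
Unset Strict Implicit.
Unset Printing Implicit Defensive.

Import Order.TTheory GRing.Theory Num.Theory.
Import numFieldNormedType.Exports.

Local Open Scope classical_set_scope.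
Local Open Scope ring_scope.

(* Partial functions on a lattice are represented by total functions R -> R;
   values off the relevant lattice are junk. *)

Section FractionalDifferences.
Context {R : realType}.
Implicit Types (a b alpha beta s t x : R) (f g : R -> R) (n : nat).

Definition N_from a : set R := [set t | exists k : nat, t = a + k%:R].
Definition N_downto b : set R := [set t | exists k : nat, t = b - k%:R].

Definition sigma t : R := t + 1.
Definition rho_pow alpha t : R := t - alpha.

Definition delta f : R -> R := fun t => f (t + 1) - f t.
Definition nabla f : R -> R := fun t => f t - f (t - 1).
Definition delta_iter n f : R -> R := iter n delta f.
Definition nabla_iter n f : R -> R := iter n nabla f.
Definition nabla_ominus n f : R -> R := fun t => (-1) ^+ n * nabla_iter n f t.

(* Euler's integral for x > 0, continued to x <= 0 by
   Gamma x = Gamma (x + m) / (x (x + 1) ... (x + m - 1)) with x + m > 0.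
   At a pole x = 0, -1, -2, ... the product contains a zero factor, so that
   Gamma x = 0 here (as 0^-1 = 0), and division by Gamma x then yields 0. *)
Definition Gamma_pos x : R :=
  Rintegral lebesgue_measure `]0, +oo[%classic
    (fun u : R => u `^ (x - 1) * expR (- u)).
Definition Gamma x : R :=
  let m := if 0 < x then 0%N else (Num.truncn (- x)).+1 in
  Gamma_pos (x + m%:R) / \prod_(k < m) (x + k%:R).

Definition factorial_fun t alpha : R := Gamma (t + 1) / Gamma (t + 1 - alpha).

(* The sum over s = a, a + 1, ..., c: the index set is finite, and it is empty
   unless c - a is a natural number. *)
Definition lattice_sum a c (F : R -> R) : R :=
  \sum_(s \in N_from a `&` N_downto c) F s.

Definition frac_sum_left a beta f : R -> R := fun t =>
  if beta == 0 then f t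
  else (Gamma beta)^-1 *
    lattice_sum a (t - beta)
      (fun s => factorial_fun (t - sigma s) (beta - 1) * f s).

Definition frac_sum_right b beta f : R -> R := fun t =>
  if beta == 0 then f t
  else (Gamma beta)^-1 *
    lattice_sum (t + beta) b
      (fun s => factorial_fun (s - sigma t) (beta - 1) * f s).

(* For alpha > 0, the integer n with n - 1 < alpha <= n. *)
Definition frac_order alpha : nat := `|Num.ceil alpha|%N.

Definition frac_diff_left a alpha f : R -> R :=
  let n := frac_order alpha in
  delta_iter n (frac_sum_left a (n%:R - alpha) f).

Definition frac_diff_right b alpha f : R -> R :=
  let n := frac_order alpha in
  nabla_ominus n (frac_sum_right b (n%:R - alpha) f).

(* fstar is the symmetric dual of a function f on N_from a `&` N_downto b. *)
Definition symmetric_dual a b f fstar : Prop :=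
  forall t, (N_from (- b) `&` N_downto (- a)) t -> fstar t = f (- t).

End FractionalDifferences.

(* Main.v *)
(* The reflection s |-> - s exchanges the left and right fractional sums and
   turns a forward difference at y into minus a backward difference at - y. *)

Require Import Defs.
From mathcomp Require Import all_boot all_order all_algebra.
From mathcomp Require Import all_classical all_reals all_analysis.
From mathcomp Require Import ring.

Import Order.TTheory GRing.Theory Num.Theory.
Import numFieldNormedType.Exports.

Local Open Scope classical_set_scope.
Local Open Scope ring_scope.

(** The kernel of a fractional sum depends only on the distance between [s] and the evaluation
    point, so reflection matches the two sums ([frac_sum_dual]). Each reflected difference
    contributes a sign, and [nabla_ominus] carries exactly the resulting factor (-1)^n
    ([delta_iter_dual]). *)

(** Agreement is asked only at the n + 1 points that an n-th difference reads, as [f] and [fstar]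
    are related only on a finite lattice. *)
Lemma delta_iter_dual (R : realType) (n : nat) (F G : R -> R) (y : R) :
  (forall j : nat, (j <= n)%N -> F (y + j%:R) = G (- (y + j%:R))) ->
  delta_iter n F y = nabla_ominus n G (- y).
Proof.
elim: n y => [|n IHn] y FG.
  by have := FG 0%N isT; rewrite addr0 /nabla_ominus expr0 mul1r.
have IHy : delta_iter n F y = nabla_ominus n G (- y).
  by apply: IHn => j jn; apply: FG; exact: leqW.
have IHy1 : delta_iter n F (y + 1) = nabla_ominus n G (- (y + 1)).
  by apply: IHn => j jn; rewrite -addrA nat1r; exact: FG.
rewrite /delta_iter iterS /delta -/(delta_iter n F) IHy IHy1.
rewrite /nabla_ominus /nabla_iter iterS /nabla -/(nabla_iter n G) exprS opprD.
ring.
Qed.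

Lemma lattice_sumN (R : realType) (a c : R) (F : R -> R) :
  lattice_sum a c F = lattice_sum (- c) (- a) (F \o -%R).
Proof.
rewrite /lattice_sum; apply: reindex_fsbig; split.
- move=> s [[k sk] [l sl]]; split.
    by exists l; rewrite sl; ring.
  by exists k; rewrite sk; ring.
- by move=> x y _ _ /oppr_inj.
- move=> s [[k sk] [l sl]]; exists (- s); last exact: opprK.
  split; first by exists l; rewrite sl; ring.
  by exists k; rewrite sk; ring.
Qed.

Lemma frac_sum_dual (R : realType) (a beta x : R) (f g : R -> R) :
  N_from a (x - beta) ->
  (forall s, (N_from a `&` N_downto (x - beta)) s -> f s = g (- s)) ->
  frac_sum_left a beta f x = frac_sum_right (- a) beta g (- x).
Proof.
move=> ax fg; rewrite /frac_sum_left /frac_sum_right.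
case: ifPn => [/eqP b0|_].
  (* For [beta = 0] the operator is the identity, so [x] itself must be a lattice point. *)
  apply: fg; move: ax; rewrite b0 subr0 => ax.
  by split=> //; exists 0%N; rewrite subr0.
(* After reflection both kernels have argument x - s - 1. *)
congr (_ * _); rewrite [RHS]lattice_sumN opprK opprD opprK.
apply: eq_fsbigr => s; rewrite inE => sP /=.
rewrite fg //; congr (factorial_fun _ _ * _).
by rewrite /sigma; ring.
Qed.

Lemma frac_orderE (R : realType) (n : nat) (alpha : R) :
  n%:R - 1 < alpha -> alpha <= n%:R -> frac_order alpha = n.
Proof.
move=> lt_n le_n; rewrite /frac_order (@ceil_def _ _ n%:Z) //.
by rewrite intrB lt_n le_n.
Qed.

Theorem theorem28 (R : realType) (a b : R) (hab : a < b) (f fstar : R -> R)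
    (hdual : symmetric_dual a b f fstar)
    (n : nat) (hn : (1 <= n)%N) (alpha : R)
    (halpha1 : n%:R - 1 < alpha) (halpha2 : alpha <= n%:R)
    (t : R) (ht : (N_from (a + n%:R) `&` N_downto b) t) :
  frac_diff_left a alpha f (rho_pow alpha t) =
  frac_diff_right (- a) alpha fstar (- rho_pow alpha t).
Proof.
rewrite /frac_diff_left /frac_diff_right (frac_orderE _ _ _ halpha1 halpha2).
apply: delta_iter_dual => j jn; rewrite /rho_pow.
case: ht => [[k tk] [l tl]]; apply: frac_sum_dual.
  (* [alpha] cancels: the upper summation limit is t - n + j. *)
  by exists (k + j)%N; rewrite tk natrD; ring.
move=> s [[p sp] [q sq]]; rewrite hdual ?opprK //; split.
  (* As j <= n, s <= t - (n - j) <= b, so duality applies at [- s]. *)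
  by exists (l + (n - j) + q)%N; rewrite sq tl !natrD natrB //; ring.
by exists p; rewrite sp; ring.
Qed.
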